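(* Let $\mathcal{H}$ and $\mathcal{K}$ be Hilbert spaces, $X\in\mathcal{B}(\mathcal{H},\mathcal{K})$, and for $T\in\mathcal{B}(\mathcal{K})$, $V\in\mathcal{B}(\mathcal{H})$ let $$R(X)=\begin{bmatrix} T & X\\ 0 & V\end{bmatrix}\in\mathcal{B}(\mathcal{K}\oplus\mathcal{H}).$$ (a) Suppose $V$ is an isometry and $T$ is a right invertible contraction. Then $R(X)$ is similar to a contraction if and only if $X=A+F$ with $A,F\in\mathcal{B}(\mathcal{H},\mathcal{K})$ satisfying $$\sup_{n\ge0}\Big\|\sum_{j=0}^{n}T^jAV^{*\,j+1}\Big\|<\infty\quad\text{and}\quad FV=0.$$ (b) Suppose $T$ is a coisometry (i.e. $TT^*=I$) and $V$ is a left invertible contraction. Then $R(X)$ is similar to a contraction if and only if $X=A+F$ with $A,F\in\mathcal{B}(\mathcal{H},\mathcal{K})$ satisfying $$\sup_{n\ge0}\Big\|\sum_{j=0}^{n}T^{*\,j+1}AV^{j}\Big\|<\infty\quad\text{and}\quad TF=0.$$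
   Context: An operator $R$ on a Hilbert space $\mathcal{E}$ is similar to a contraction if there is an invertible $L\in\mathcal{B}(\mathcal{E})$ with $\|L^{-1}RL\|\le1$. *)

(* Defs.v *)
(* complex Hilbert spaces over C := R[i], R : realType. *)
From HB Require Import structures.
From mathcomp Require Import all_boot all_order all_algebra.
From mathcomp Require Import complex.
From mathcomp Require Import reals.
Set Implicit Arguments. Unset Strict Implicit. Unset Printing Implicit Defensive.
Import Order.TTheory GRing.Theory Num.Theory.
Local Open Scope ring_scope.

Section Hilbert.
Variable R : realType.
Local Notation C := R[i].

(* An inner product space over C (linear in the first argument,
   conjugate-linear in the second) which is complete for the induced norm. *)
Definition hnorm (V : lmodType C) (ip : V -> V -> C) (x : V) : C :=
  sqrtC (ip x x).

Definition is_hilbert (V : lmodType C) (ip : V -> V -> C) : Prop :=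
  [/\ (forall (a : C) (x y z : V), ip (a *: x + y) z = a * ip x z + ip y z),
      (forall x y : V, ip x y = (ip y x)^*),
      (forall x : V, 0 <= ip x x),
      (forall x : V, ip x x = 0 -> x = 0) &
      (forall u : nat -> V,
         (forall eps : C, 0 < eps -> exists N : nat, forall m n : nat,
            (N <= m)%N -> (N <= n)%N -> hnorm ip (u m - u n) < eps) ->
         exists l : V, forall eps : C, 0 < eps -> exists N : nat,
            forall n : nat, (N <= n)%N -> hnorm ip (u n - l) < eps)].

(* boundedness of a map between normed spaces (norms given explicitly) *)
Definition bounded_op (U W : Type) (nU : U -> C) (nW : W -> C) (f : U -> W) :=
  exists M : C, forall x : U, nW (f x) <= M * nU x.

(* Norm of the orthogonal direct sum K (+) H, realized on pairs. *)
Definition sum_norm (K H : lmodType C) (ipK : K -> K -> C) (ipH : H -> H -> C)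
  (z : K * H) : C := sqrtC (ipK z.1 z.1 + ipH z.2 z.2).

(* The upper-triangular operator matrix R(X) = [T X; 0 V] on K (+) H. *)
Definition block_op (K H : lmodType C) (T : K -> K) (X : H -> K) (V : H -> H)
  (z : K * H) : K * H := (T z.1 + X z.2, V z.2).

(* S is similar to a contraction: there is an invertible bounded operator L
   on the Hilbert space E (with bounded inverse Linv) with ||Linv S L|| <= 1. *)
Definition similar_to_contraction (E : lmodType C) (nE : E -> C) (S : E -> E) :=
  exists (L Linv : {linear E -> E}),
    [/\ bounded_op nE nE L, bounded_op nE nE Linv,
        cancel L Linv, cancel Linv L &
        forall z : E, nE (Linv (S (L z))) <= nE z].

(* Sst is the Hilbert-space adjoint of S. *)
Definition is_adjoint (U W : lmodType C) (ipU : U -> U -> C) (ipW : W -> W -> C)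
  (S : U -> W) (Sst : W -> U) :=
  forall (x : U) (y : W), ipW (S x) y = ipU x (Sst y).

End Hilbert.

(* Main.v *)
Require Import Defs.
From HB Require Import structures.
From mathcomp Require Import all_boot all_order all_algebra.
From mathcomp Require Import complex reals.
From mathcomp Require Import boolp classical_sets filter.
From mathcomp Require Import ring lra.
Import Order.TTheory GRing.Theory Num.Theory.
Local Open Scope ring_scope.
Set Implicit Arguments. Unset Strict Implicit. Unset Printing Implicit Defensive.

(** In both parts the two conditions are equivalent to the existence of a bounded
    [Z : H -> K] with [X = Z V - T Z]; a shear by [Z] then conjugates [R(X)] to [T (+) V].

    If the sums [Y_n] attached to [A] are bounded, they satisfy [Y_(n+1) V = T Y_n + A]
    (resp. [T Y_(n+1) = A + Y_n V]), so a Banach limit of [Y_n] solves the equation for [A];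
    a one-sided inverse [S] of [T] (resp. of [V]) solves it for [F] through [S F] (resp. [F S]).

    Conversely, let [R(X)] be a contraction for an equivalent Hilbert norm [e] on [K (+) H].
    In (a), one seeks a bounded section [h |-> (Z h, h)] intertwining [V] and [R(X)]; in (b), a
    bounded projection [(k, h) |-> k - Z h] intertwining [R(X)] and [T].  Given any section
    [Z_n], its [V]-translate [Z_(n+1) V = T Z_n + X] is prescribed on the range of [V] only,
    and an orthogonal projection for a suitable defect form extends it to all of [H] with
    essentially no increase of the norm.  Iterating this one-step extension and taking a
    Banach limit of the [Z_n] yields an intertwining [Z]; no isometric dilation is needed.
    Given [Z], one takes [A = Z' V - T Z'] with [Z' = Z V V^*] (resp. [Z' = T^* T Z]), whose
    sums telescope. *)

(** * Hermitian forms and the Riesz representation *)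

(** Only positive semidefinite: definiteness and completeness are separate, since one space carries
    several forms (renormings, defect forms, pullbacks). *)
Definition hermitian_form (R : realType) (E : lmodType R[i]) (a : E -> E -> R[i]) :=
  [/\ forall (c : R[i]) (x y z : E), a (c *: x + y) z = c * a x z + a y z,
      forall x y : E, a x y = (a y x)^* &
      forall x : E, 0 <= a x x].

(** A real-valued squared norm keeps the estimates free of square roots and open to [lra]. *)
Definition sqn (R : realType) (E : lmodType R[i]) (a : E -> E -> R[i]) (x : E) : R :=
  complex.Re (a x x).

Definition sqn_complete (R : realType) (E : lmodType R[i]) (a : E -> E -> R[i]) :=
  forall u : nat -> E,
    (forall eps : R, 0 < eps -> exists N, forall m n,
       (N <= m)%N -> (N <= n)%N -> sqn a (u m - u n) < eps) ->
    exists l, forall eps : R, 0 < eps -> exists N, forall n,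
       (N <= n)%N -> sqn a (u n - l) < eps.

(** The minimiser [t = - b / c] gives the bound; if [c = 0], an affine function bounded below has
    slope zero. *)
Lemma quadratic_discriminant (R : realType) (p b c : R) :
  0 <= p -> 0 <= c -> (forall t : R, 0 <= p + 2 * t * b + t ^+ 2 * c) -> b ^+ 2 <= p * c.
Proof.
move=> p0 c0 h; have [ce|cn0] := eqVneq c 0.
  have [->|bn0] := eqVneq b 0; first by rewrite ce mulr0 expr0n.
  have := h (- (p + 1) / b).
  rewrite (_ : _ + _ = - p - 2); last by rewrite ce; field.
  by move=> h1; exfalso; lra.
have cp : 0 < c by rewrite lt_def cn0.
have := h (- b / c).
rewrite (_ : _ + _ = (p * c - b ^+ 2) / c); last by field.
by rewrite pmulr_lge0 ?invr_gt0 // subr_ge0.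
Qed.

Lemma natSinv_small (R : realType) (eps : R) :
  0 < eps -> exists N, forall n, (N <= n)%N -> n.+1%:R^-1 < eps.
Proof.
move=> e0; exists (Num.bound eps^-1) => n hn.
rewrite invf_plt ?posrE ?ltr0Sn //.
apply: (lt_le_trans (archi_boundP _)); first by rewrite invr_ge0 ltW.
by rewrite ler_nat; apply: leq_trans hn _.
Qed.

Lemma linear_map_of (R : pzRingType) (U W : lmodType R) (f : U -> W) :
  linear f -> exists g : {linear U -> W}, g =1 f.
Proof.
move=> fL; pose M := GRing.isLinear.Build _ _ _ _ f fL.
by exists (HB.pack_for {linear U -> W} f M).
Qed.

Section HermitianForms.
Variables (R : realType) (E : lmodType R[i]) (a : E -> E -> R[i]).
Hypothesis ha : hermitian_form a.
Implicit Types x y z : E.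

Lemma hformC x y : a x y = (a y x)^*. Proof. by case: ha. Qed.
Lemma hformDl x y z : a (x + y) z = a x z + a y z.
Proof. by case: ha => h _ _; rewrite -[x in LHS]scale1r h mul1r. Qed.
Lemma hform0l z : a 0 z = 0.
Proof. by apply: (addrI (a 0 z)); rewrite -hformDl !addr0. Qed.
Lemma hformZl c x z : a (c *: x) z = c * a x z.
Proof. by case: ha => h _ _; rewrite -[c *: x]addr0 h hform0l addr0. Qed.
Lemma hformNl x z : a (- x) z = - a x z.
Proof. by rewrite -scaleN1r hformZl mulN1r. Qed.
Lemma hformBl x y z : a (x - y) z = a x z - a y z.
Proof. by rewrite hformDl hformNl. Qed.
Lemma hformDr x y z : a z (x + y) = a z x + a z y.
Proof. by rewrite (hformC z) hformDl rmorphD /= (hformC z x) (hformC z y). Qed.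
Lemma hformZr c x z : a z (c *: x) = c^* * a z x.
Proof. by rewrite (hformC z) hformZl rmorphM /= (hformC z x). Qed.
Lemma hformNr x z : a z (- x) = - a z x.
Proof. by rewrite (hformC z) hformNl rmorphN /= (hformC z x). Qed.
Lemma hformBr x y z : a z (x - y) = a z x - a z y.
Proof. by rewrite hformDr hformNr. Qed.

Lemma sqnE x : a x x = (sqn a x)%:C%C.
Proof.
case: ha => _ _ /(_ x); rewrite /sqn.
by case: (a x x) => r i; rewrite lecE /= => /andP[/eqP -> _].
Qed.

Lemma sqn_ge0 x : 0 <= sqn a x.
Proof. by case: ha => _ _ /(_ x); rewrite sqnE ler0c. Qed.

Lemma ReC x y : complex.Re (a x y) = complex.Re (a y x).
Proof. by rewrite hformC; case: (a y x). Qed.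

Lemma sqnD x y : sqn a (x + y) = sqn a x + 2 * complex.Re (a x y) + sqn a y.
Proof.
rewrite /sqn !hformDl !hformDr !raddfD /= (ReC y x); ring.
Qed.

Lemma sqnN x : sqn a (- x) = sqn a x.
Proof. by rewrite /sqn hformNl hformNr opprK. Qed.

Lemma sqnB x y : sqn a (x - y) = sqn a x - 2 * complex.Re (a x y) + sqn a y.
Proof. by rewrite sqnD sqnN hformNr raddfN /= mulrN. Qed.

Lemma sqn0 : sqn a 0 = 0. Proof. by rewrite /sqn hform0l. Qed.

Lemma Re_formZ (t : R) x y : complex.Re (a (t%:C%C *: x) y) = t * complex.Re (a x y).
Proof. by rewrite hformZl; case: (a x y) => u v /=; rewrite mul0r subr0. Qed.

Lemma sqnZ (t : R) x : sqn a (t%:C%C *: x) = t ^+ 2 * sqn a x.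
Proof. by rewrite /sqn Re_formZ ReC Re_formZ expr2 mulrA. Qed.

Lemma form_cauchy_schwarz x y : complex.Re (a x y) ^+ 2 <= sqn a x * sqn a y.
Proof.
rewrite mulrC; apply: quadratic_discriminant; rewrite ?sqn_ge0 // => t.
by have := sqn_ge0 (t%:C%C *: x + y); rewrite sqnD sqnZ Re_formZ; lra.
Qed.

Lemma sqnD_le x y : sqn a (x + y) <= 2 * sqn a x + 2 * sqn a y.
Proof. by have := sqn_ge0 (x - y); rewrite sqnB sqnD; lra. Qed.

Lemma sqnB_le x y : sqn a (x - y) <= 2 * sqn a x + 2 * sqn a y.
Proof. by have := sqnD_le x (- y); rewrite sqnN. Qed.

End HermitianForms.

(** [Re (f (i x))] is [- Im (f x)], so the imaginary parts vanish as well. *)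
Lemma Re_linear_inj (R : realType) (E : lmodType R[i]) (f : E -> R[i]) :
  (forall (c : R[i]) x, f (c *: x) = c * f x) ->
  (forall x, complex.Re (f x) = 0) -> forall x, f x = 0.
Proof.
move=> fZ f0 x; have := f0 (complex.Complex 0 1 *: x); rewrite fZ.
have := f0 x; case: (f x) => u v /= -> ; rewrite mul0r mul1r sub0r => /eqP.
by rewrite oppr_eq0 => /eqP ->.
Qed.

Section Riesz.
Variables (R : realType) (E : lmodType R[i]) (a : E -> E -> R[i]).
Hypotheses (ha : hermitian_form a) (ca : sqn_complete a).

(* Minimises [|y|^2 - 2 Re (f y)]: a minimising sequence is Cauchy by the parallelogram law. *)
Lemma riesz (f : E -> R[i]) (M : R) :
  (forall (c : R[i]) x y, f (c *: x + y) = c * f x + f y) ->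
  (forall x, complex.Re (f x) ^+ 2 <= M * sqn a x) ->
  exists y, forall x, f x = a x y.
Proof.
move=> fL fM.
have f0 : f 0 = 0.
  by have := fL 1 0 0; rewrite scale1r addr0 mul1r => /esym/eqP; rewrite addrC -subr_eq0 addrK => /eqP.
have fD x y : f (x + y) = f x + f y by rewrite -[x in LHS]scale1r fL mul1r.
have fZ c x : f (c *: x) = c * f x by rewrite -[c *: x]addr0 fL f0 addr0.
have RefZ (t : R) x : complex.Re (f (t%:C%C *: x)) = t * complex.Re (f x).
  by rewrite fZ; case: (f x) => u v /=; rewrite mul0r subr0.
have RefD x y : complex.Re (f (x + y)) = complex.Re (f x) + complex.Re (f y).
  by rewrite fD raddfD.
pose J y : R := sqn a y - 2 * complex.Re (f y).
(* With [s = sqn a y], [2 |Re (f y)| <= 2 sqrt (|M| s) <= |M| + s]. *)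
have Jlb y : - `|M| <= J y.
  rewrite /J; have := fM y; have := sqn_ge0 ha y.
  set s := sqn a y; set r := complex.Re (f y) => s0 h.
  have h' : r ^+ 2 <= `|M| * s by apply: le_trans h _; rewrite ler_wpM2r // ler_norm.
  have := normr_ge0 M; set m := `|M| in h' *; move=> m0.
  rewrite leNgt; apply/negP => hlt.
  have : 0 < (2 * r) ^+ 2 - (s + m) ^+ 2.
    by rewrite subr_sqr mulr_gt0 //; lra.
  have := sqr_ge0 (s - m); nra.
have hinf : has_inf (range J).
  by split; [exists (J 0); exists 0 | exists (- `|M|) => _ [y _ <-]].
pose i := inf (range J).
have iJ y : i <= J y by apply: ge_inf; [exact: hinf.2 | exists y].
have /choice[u uJ] : forall n : nat, exists y, J y < i + n.+1%:R^-1.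
  move=> n; have n0 : 0 < n.+1%:R^-1 :> R by rewrite invr_gt0 ltr0Sn.
  have [_ [y _ <-] h] := inf_adherent n0 hinf.
  by exists y.
(* Compare with the midpoint of [u m] and [u n], where [J] is still at least [i]. *)
have ucau m n : sqn a (u m - u n) <= 2 * m.+1%:R^-1 + 2 * n.+1%:R^-1.
  have := iJ ((2^-1)%:C%C *: (u m + u n)).
  have := uJ m; have := uJ n; rewrite /J (sqnZ ha) RefZ (sqnD ha) RefD (sqnB ha).
  by move: (n.+1%:R^-1) (m.+1%:R^-1) => e1 e2; lra.
have [y hy] : exists l, forall eps : R, 0 < eps -> exists N, forall n,
       (N <= n)%N -> sqn a (u n - l) < eps.
  apply: ca => eps e0; have e4 : 0 < eps / 4 by lra.
  have [N hN] := natSinv_small e4.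
  exists N => m n hm hn; apply: le_lt_trans (ucau m n) _.
  have := hN m hm; have := hN n hn.
  by move: (n.+1%:R^-1) (m.+1%:R^-1) => e1 e2; lra.
exists y => x; apply/eqP; rewrite -subr_eq0; apply/eqP; move: x.
apply: (@Re_linear_inj R E (fun x => f x - a x y)).
  by move=> c x; rewrite fZ (hformZl ha) mulrBr.
move=> x; rewrite raddfB /=.
(* Moving [u n] by [t x] lowers [J] by at most [1 / (n + 1)]; the discriminant of this quadratic in
   [t] gives an approximate Euler equation. *)
have h1 n : (complex.Re (a x (u n)) - complex.Re (f x)) ^+ 2 <= n.+1%:R^-1 * sqn a x.
  apply: quadratic_discriminant; rewrite ?invr_ge0 ?(sqn_ge0 ha) // => t.
  have := uJ n; have := iJ (t%:C%C *: x + u n).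
  rewrite /J (sqnD ha) (sqnZ ha) RefD RefZ (Re_formZ ha).
  by move: (n.+1%:R^-1) => e; lra.
have h2 n : (complex.Re (a x (u n)) - complex.Re (a x y)) ^+ 2 <= sqn a x * sqn a (u n - y).
  by have := form_cauchy_schwarz ha x (u n - y); rewrite (hformBr ha) raddfB.
set d := _ - _.
(* The factor 4 comes from [(p - q)^2 <= 2 (r - p)^2 + 2 (r - q)^2], with [h1] and [h2] bounding the
   two squares. *)
have d2 (eps : R) : 0 < eps -> d ^+ 2 <= (4 * sqn a x) * eps.
  move=> e0; have [N1 hN1] := hy _ e0; have [N2 hN2] := natSinv_small e0.
  pose n := maxn N1 N2.
  have := hN1 n (leq_maxl _ _); have := hN2 n (leq_maxr _ _).
  have := h1 n; have := h2 n; have := sqn_ge0 ha x; rewrite /d.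
  move: (n.+1%:R^-1) (sqn a x) (sqn a (u n - y)) (complex.Re (a x (u n))) => e1 s e2 r s0 k2 k1 l1 l2.
  have : s * e2 <= s * eps by rewrite ler_wpM2l // ltW.
  have : s * e1 <= s * eps by rewrite ler_wpM2l // ltW.
  move: (complex.Re (f x)) (complex.Re (a x y)) k1 k2 => p q.
  have := sqr_ge0 ((r - p) + (r - q)); rewrite !expr2; lra.
apply/eqP; rewrite -sqrf_eq0 -[_ == 0]/(d ^+ 2 == 0) eq_le sqr_ge0 andbT.
apply/ler_addgt0Pr => e e0; rewrite add0r.
have s1 : 0 < 4 * sqn a x + 1 by have := sqn_ge0 ha x; lra.
apply: le_trans (d2 (e / (4 * sqn a x + 1)) (divr_gt0 e0 s1)) _.
by rewrite mulrA ler_pdivrMr //; lra.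
Qed.

Hypothesis da : forall x, a x x = 0 -> x = 0.

(** Riesz applies to each functional [x |-> (b z x)^*], conjugated to be linear; definiteness makes
    the representing vector unique, hence linear in [z]. *)
Lemma riesz_operator (U : lmodType R[i]) (b : U -> E -> R[i]) :
  (forall (c : R[i]) z z' x, b (c *: z + z') x = c * b z x + b z' x) ->
  (forall z (c : R[i]) x y, b z (c *: x + y) = c^* * b z x + b z y) ->
  (forall z, exists M : R, forall x, complex.Re (b z x) ^+ 2 <= M * sqn a x) ->
  exists l : {linear U -> E}, forall z x, a (l z) x = b z x.
Proof.
move=> bl br bM.
have /choice[l hl] : forall z, exists y, forall x, (b z x)^* = a x y.
  move=> z; have [M hM] := bM z; apply: (@riesz _ M).
    by move=> c x y; rewrite br rmorphD rmorphM /= conjCK.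
  by move=> x; have := hM x; case: (b z x).
have hl' z x : a (l z) x = b z x by rewrite (hformC ha) -hl conjCK.
have ll : linear l.
  move=> c z z'; apply/eqP; rewrite -subr_eq0; apply/eqP/da.
  by rewrite (hformBl ha) (hformDl ha) (hformZl ha) !hl' bl subrr.
by have [g gE] := linear_map_of ll; exists g => z x; rewrite gE.
Qed.

End Riesz.

(** * Banach limits *)

Definition bounded_seq (R : realType) (u : nat -> R) := exists B : R, forall n, u n ^+ 2 <= B.

Lemma bounded_seq_norm (R : realType) (u : nat -> R) :
  bounded_seq u -> exists M, forall n, `|u n| <= M.
Proof.
move=> [B hB]; exists (Num.sqrt B) => n.
by rewrite -sqrtr_sqr ler_wsqrtr.
Qed.

Lemma norm_bounded_seq (R : realType) (u : nat -> R) M :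
  (forall n, `|u n| <= M) -> bounded_seq u.
Proof.
move=> h; exists (M ^+ 2) => n; rewrite -real_normK ?num_real //.
by rewrite lerXn2r ?nnegrE // (le_trans _ (h n)).
Qed.

Lemma bounded_seq_lin (R : realType) (c : R) (u v : nat -> R) :
  bounded_seq u -> bounded_seq v -> bounded_seq (fun n => c * u n + v n).
Proof.
move=> [B hB] [B' hB']; exists (2 * (c ^+ 2 * B) + 2 * B') => n.
have := hB' n; have : c ^+ 2 * u n ^+ 2 <= c ^+ 2 * B by rewrite ler_wpM2l ?sqr_ge0.
by have := sqr_ge0 (c * u n - v n); lra.
Qed.

Section UltrafilterLimit.
Variables (R : realType) (U : set_system nat).
Hypothesis UU : UltraFilter U.
Local Open Scope classical_set_scope.

Definition ulim (u : nat -> R) (l : R) :=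
  forall e : R, 0 < e -> U [set n | `|u n - l| < e].

(** The limit is the supremum of the [x] that stay below [u n] for [U]-almost all [n]; the
    ultrafilter dichotomy excludes [sup S + e <= u n] on a set of [U]. *)
Lemma ulim_exists u : bounded_seq u -> exists l, ulim u l.
Proof.
move=> /bounded_seq_norm[M hM].
pose S : set R := [set x | U [set n | x <= u n]].
have SM x : S x -> x <= M.
  move=> /filter_ex[n /= hx]; apply: le_trans hx _.
  exact: le_trans (ler_norm _) (hM n).
have hS : has_sup S.
  split; last by exists M => x /SM.
  exists (- M); apply: filterS filterT => n _ /=.
  by rewrite lerNl (le_trans _ (hM n)) // -normrN ler_norm.
exists (sup S) => e e0.
have [x Sx hx] := sup_adherent e0 hS.
have [S'|] := in_ultra_setVsetC [set n | sup S + e <= u n] UU.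
  have : sup S + e <= sup S by apply: ub_le_sup; [exact: hS.2|].
  by move=> h; exfalso; lra.
move=> S'; apply: filterS (filterI Sx S') => n [/= h1 /negP]; rewrite -ltNge => h2.
rewrite ltr_norml; apply/andP; split; lra.
Qed.

Lemma ulim_unique u l l' : ulim u l -> ulim u l' -> l = l'.
Proof.
move=> h h'; apply/eqP; rewrite -subr_eq0 -normr_le0; apply/ler_addgt0Pr => e e0.
have e2 : 0 < e / 2 by lra.
have [n [/= h1 h2]] := filter_ex (filterI (h _ e2) (h' _ e2)).
rewrite add0r (_ : l - l' = (u n - l') - (u n - l)); last by ring.
by apply: le_trans (ler_normB _ _) _; lra.
Qed.

Lemma ulim_linear c u v l m :
  ulim u l -> ulim v m -> ulim (fun n => c * u n + v n) (c * l + m).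
Proof.
move=> hu hv e e0.
have c0 : 0 < `|c| + 1 by have := normr_ge0 c; lra.
have e1 : 0 < e / 2 / (`|c| + 1) by rewrite divr_gt0 //; lra.
have e2 : 0 < e / 2 by lra.
apply: filterS (filterI (hu _ e1) (hv _ e2)) => n [/= h1 h2].
rewrite (_ : _ - _ = c * (u n - l) + (v n - m)); last by ring.
apply: le_lt_trans (ler_normD _ _) _; rewrite normrM.
have : `|c| * `|u n - l| <= e / 2.
  move: h1; rewrite ltr_pdivlMr // => h1.
  by have := normr_ge0 (u n - l); lra.
lra.
Qed.

Lemma ulim_le u l B : ulim u l -> (forall n, u n <= B) -> l <= B.
Proof.
move=> h hB; apply/ler_addgt0Pr => e e0.
by have [n /=] := filter_ex (h _ e0); have := hB n; rewrite ltr_norml => ? /andP[]; lra.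
Qed.

Lemma cvg_ulim u : \oo `<=` U ->
  (forall e : R, 0 < e -> exists N, forall n, (N <= n)%N -> `|u n| < e) -> ulim u 0.
Proof.
move=> sU h e e0; apply: sU; have [N hN] := h _ e0.
by exists N => // n /= /hN; rewrite subr0.
Qed.

End UltrafilterLimit.

(* [L] is the limit of the Cesaro means along a free ultrafilter. *)
Lemma banach_limit (R : realType) : exists L : (nat -> R) -> R,
  [/\ forall c u v, bounded_seq u -> bounded_seq v ->
        L (fun n => c * u n + v n) = c * L u + L v,
      forall c, L (fun=> c) = c,
      forall u B, (forall n, u n ^+ 2 <= B) -> L u ^+ 2 <= B &
      forall u, bounded_seq u -> L (fun n => u n.+1) = L u].
Proof.
have [U [UU sU]] := @ultraFilterLemma nat (eventually) _.
pose ces (u : nat -> R) N := (\sum_(k < N.+1) u k) / N.+1%:R.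
have cesM u M : (forall n, `|u n| <= M) -> forall n, `|ces u n| <= M.
  move=> h n; rewrite /ces normrM [`|_^-1|]ger0_norm ?invr_ge0 // ler_pdivrMr ?ltr0Sn //.
  apply: le_trans (ler_norm_sum _ _ _) _.
  rewrite (_ : M * _ = \sum_(k < n.+1) M); last by rewrite sumr_const card_ord mulr_natr.
  by apply: ler_sum => k _; exact: h.
have ces_bd u : bounded_seq u -> bounded_seq (ces u).
  by move=> /bounded_seq_norm[M /cesM h]; apply: norm_bounded_seq h.
(* Only bounded sequences get a meaningful value; for the others the witness 0 is a default. *)
have /choice[L hL] : forall u, exists l, bounded_seq u -> ulim U (ces u) l.
  move=> u; have [/ces_bd /(ulim_exists UU)[l hl]|nb] := pselect (bounded_seq u).
    by exists l.
  by exists 0.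
have Lu u l : bounded_seq u -> ulim U (ces u) l -> L u = l.
  by move=> bu; apply: ulim_unique UU _ _ _ _; apply: hL.
have Llin c u v : bounded_seq u -> bounded_seq v ->
        L (fun n => c * u n + v n) = c * L u + L v.
  move=> bu bv; apply: Lu; first exact: bounded_seq_lin.
  rewrite (_ : ces _ = fun n => c * ces u n + ces v n).
    by apply: ulim_linear; apply: hL.
  by apply/funext => n; rewrite /ces big_split -mulr_sumr /=; ring.
have Lle u B : bounded_seq u -> (forall n, `|u n| <= B) -> L u <= B.
  move=> bu h; apply: (ulim_le UU (hL _ bu)) => n.
  exact: le_trans (ler_norm _) (cesM _ _ h n).
have cst_bd c : bounded_seq (fun=> c : R) by exists (c ^+ 2).
have Lcst c : L (fun=> c) = c.
  apply: Lu => // e e0; apply: filterS filterT => n _ /=.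
  rewrite /ces sumr_const card_ord -[c *+ _]mulr_natr mulfK ?subrr ?normr0 //.
  by rewrite pnatr_eq0.
exists L; split=> //.
- move=> u B h; have bu : bounded_seq u by exists B.
  have B0 : 0 <= B by apply: le_trans (sqr_ge0 _) (h 0%N).
  have hs n : `|u n| <= Num.sqrt B by rewrite -sqrtr_sqr ler_wsqrtr.
  have h1 := Lle _ _ bu hs.
  (* The upper bound for [- u] is the lower bound for [u]. *)
  have : L (fun n => (-1) * u n + 0) <= Num.sqrt B.
    apply: Lle; first exact: bounded_seq_lin.
    by move=> n; rewrite addr0 mulN1r normrN.
  rewrite Llin // Lcst.
  move=> h2; rewrite -(sqr_sqrtr B0) -real_normK ?num_real //.
  by rewrite lerXn2r ?nnegrE ?sqrtr_ge0 // ler_norml; apply/andP; split; lra.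
- move=> u bu; apply: Lu.
    by case: bu => B hB; exists B => n.
  (* Shifting changes the Cesaro mean by a boundary term that tends to 0. *)
  have -> : ces (fun n => u n.+1) = fun n => 1 * ces u n + (u n.+1 - u 0%N) / n.+1%:R.
    apply/funext => n; rewrite mul1r /ces -mulrDl; congr (_ / _).
    have : \sum_(k < n.+2) u k = \sum_(k < n.+1) u k + u n.+1 by rewrite big_ord_recr.
    rewrite big_ord_recl /bump /=.
    by lra.
  rewrite -[L u]mul1r -[1 * L u]addr0; apply: ulim_linear; first exact: hL.
  apply: cvg_ulim => // e e0.
  have [M hM] := bounded_seq_norm bu.
  have M0 : 0 < 2 * M + 1 by have := normr_ge0 (u 0%N); have := hM 0%N; lra.
  have [N hN] := natSinv_small (divr_gt0 e0 M0).
  exists N => n /hN; rewrite normrM [`|_^-1|]ger0_norm ?invr_ge0 //.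
  have : `|u n.+1 - u 0%N| <= 2 * M + 1.
    apply: le_trans (ler_normB _ _) _.
    by have := hM n.+1; have := hM 0%N; lra.
  move=> h; rewrite ltr_pdivlMr // mulrC; apply: le_lt_trans.
  by rewrite ler_wpM2r ?invr_ge0.
Qed.

Definition bounded_cseq (R : realType) (u : nat -> R[i]) :=
  bounded_seq (fun n => complex.Re (u n)) /\ bounded_seq (fun n => complex.Im (u n)).

Lemma complex_banach_limit (R : realType) : exists L : (nat -> R[i]) -> R[i],
  [/\ forall c u v, bounded_cseq u -> bounded_cseq v ->
        L (fun n => c * u n + v n) = c * L u + L v,
      forall c, L (fun=> c) = c,
      forall u B, (forall n, complex.Re (u n) ^+ 2 <= B) -> complex.Re (L u) ^+ 2 <= B &
      forall u, bounded_cseq u -> L (fun n => u n.+1) = L u].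
Proof.
have [L [Llin Lcst Lsq Lsh]] := banach_limit R.
exists (fun u => complex.Complex (L (fun n => complex.Re (u n))) (L (fun n => complex.Im (u n)))).
split.
- move=> [p q] u v [bur bui] [bvr bvi].
  rewrite (_ : (fun n => complex.Re _) =
      fun n => p * complex.Re (u n) + ((- q) * complex.Im (u n) + complex.Re (v n))); last first.
    by apply/funext => n; case: (u n) (v n) => ? ? [? ?] /=; ring.
  rewrite (_ : (fun n => complex.Im (_ + _)) =
      fun n => p * complex.Im (u n) + (q * complex.Re (u n) + complex.Im (v n))); last first.
    by apply/funext => n; case: (u n) (v n) => ? ? [? ?] /=; ring.
  rewrite !Llin //; try exact: bounded_seq_lin.
  by apply/eqP; rewrite eq_complex /=; apply/andP; split; apply/eqP; ring.
- by move=> [p q] /=; rewrite !Lcst.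
- by move=> u B h /=; apply: Lsq.
- by move=> u [br bi]; rewrite !(Lsh (fun n => _ (u n))).
Qed.

(** * Weak Banach limits of operators *)

Section Intertwiner.
Variables (R : realType) (K H : lmodType R[i]).
Variables (ipK : K -> K -> R[i]) (ipH : H -> H -> R[i]).
Hypotheses (hK : hermitian_form ipK) (cK : sqn_complete ipK).
Hypothesis dK : forall x, ipK x x = 0 -> x = 0.

Lemma form_bounded_cseq (Z : nat -> H -> K) M h k :
  (forall n x, sqn ipK (Z n x) <= M * sqn ipH x) ->
  bounded_cseq (fun n => ipK (Z n h) k).
Proof.
move=> ZM.
have hb k' : bounded_seq (fun n => complex.Re (ipK (Z n h) k')).
  exists (M * sqn ipH h * sqn ipK k') => n.
  apply: le_trans (form_cauchy_schwarz hK _ _) _.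
  by rewrite ler_wpM2r // (sqn_ge0 hK).
(* The imaginary part against [k] is the real part against [i k]. *)
split=> //; have [B hB] := hb (complex.Complex 0 1 *: k); exists B => n.
apply: le_trans (hB n); rewrite (hformZr hK).
by case: (ipK _ _) => p q /=; rewrite mul0r sub0r mulNr mul1r opprK.
Qed.

Lemma form_ext x y : (forall k, ipK x k = ipK y k) -> x = y.
Proof.
move=> h; apply/eqP; rewrite -subr_eq0; apply/eqP/dK.
by rewrite (hformBl hK) h subrr.
Qed.

(** [W] is the weak Banach limit of the [Z n]; shift invariance erases the offsets [i] and [j], and
    [T] passes through the limit by its adjoint. Offsets 1, 0 serve the forward recursion of part
    (a), offsets 0, 1 the backward one of part (b). *)
Lemma intertwiner_of_bounded_sequence (T Tst : K -> K) (Y : H -> K) (V : H -> H)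
    (Z : nat -> {linear H -> K}) (M : R) (i j : nat) :
  (forall x y, ipK (T x) y = ipK x (Tst y)) ->
  (forall n h, sqn ipK (Z n h) <= M * sqn ipH h) ->
  (forall n h, Z (n + i)%N (V h) = T (Z (n + j)%N h) + Y h) ->
  exists W : {linear H -> K},
    (forall h, sqn ipK (W h) <= M * sqn ipH h) /\ forall h, W (V h) = T (W h) + Y h.
Proof.
move=> adjT ZM ZV.
have bd h k : bounded_cseq (fun n => ipK (Z n h) k) by apply: form_bounded_cseq ZM.
have [L [Llin Lcst Lsq Lsh]] := complex_banach_limit R.
have Lshift m h k : L (fun n => ipK (Z (n + m)%N h) k) = L (fun n => ipK (Z n h) k).
  elim: m => [|m IH]; first by congr L; apply/funext => n; rewrite addn0.
  rewrite -IH -[RHS]Lsh; first by congr L; apply/funext => n; rewrite addnS.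
  by apply: (@form_bounded_cseq (fun n => Z (n + m)%N) M) => n x; exact: ZM.
have [W hW] : exists W : {linear H -> K}, forall h k, ipK (W h) k = L (fun n => ipK (Z n h) k).
  apply: (riesz_operator hK cK dK).
  - move=> c z z' x; rewrite -Llin //; congr L; apply/funext => n.
    by rewrite linearP (hformDl hK) (hformZl hK).
  - move=> z c x y.
    rewrite -Llin //; congr L; apply/funext => n.
    by rewrite (hformDr hK) (hformZr hK).
  - move=> z; exists (M * sqn ipH z) => x; apply: Lsq => n.
    apply: le_trans (form_cauchy_schwarz hK _ _) _.
    by rewrite ler_wpM2r // (sqn_ge0 hK).
exists W; split=> h.
  (* Test the weak limit against [W h] itself, then divide by [sqn ipK (W h)]. *)
  have : complex.Re (ipK (W h) (W h)) ^+ 2 <= M * sqn ipH h * sqn ipK (W h).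
    rewrite hW; apply: Lsq => n; apply: le_trans (form_cauchy_schwarz hK _ _) _.
    by rewrite ler_wpM2r // (sqn_ge0 hK).
  rewrite -/(sqn ipK (W h)) expr2.
  have [->|W0] := eqVneq (sqn ipK (W h)) 0.
    move=> _; exact: le_trans (sqn_ge0 hK (Z 0%N h)) (ZM _ _).
  by rewrite ler_pM2r // lt_def W0 (sqn_ge0 hK).
apply: form_ext => k; rewrite (hformDl hK) adjT !hW -(Lshift i) -(Lshift j).
rewrite -[ipK (Y h) k]Lcst -[X in X + _]mul1r -Llin; last 2 first.
- by apply: (@form_bounded_cseq (fun n => Z (n + j)%N) M) => n x; exact: ZM.
- split.
    by exists (complex.Re (ipK (Y h) k) ^+ 2).
  by exists (complex.Im (ipK (Y h) k) ^+ 2).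
congr L; apply/funext => n.
by rewrite ZV (hformDl hK) adjT mul1r.
Qed.

End Intertwiner.

(** * Intertwining extensions *)

Lemma sqnD_orth (R : realType) (E : lmodType R[i]) (a : E -> E -> R[i]) x y :
  hermitian_form a -> a x y = 0 -> sqn a (x + y) = sqn a x + sqn a y.
Proof. by move=> ha h; rewrite (sqnD ha) h /= mulr0 addr0. Qed.

Section EquivalentForms.
Variables (R : realType) (E : lmodType R[i]) (a a' : E -> E -> R[i]) (c1 c2 : R).
Hypotheses (ha : hermitian_form a) (ha' : hermitian_form a').
Hypotheses (c1_gt0 : 0 < c1).
Hypotheses (le1 : forall x, c1 * sqn a x <= sqn a' x).

Lemma definite_equiv : (forall x, a x x = 0 -> x = 0) -> forall x, a' x x = 0 -> x = 0.
Proof.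
move=> da x h; apply: da; rewrite (sqnE ha).
have := le1 x; rewrite /sqn h /= -/(sqn a x) pmulr_rle0 // => h0.
by have -> : sqn a x = 0 by apply/eqP; rewrite eq_le h0 (sqn_ge0 ha).
Qed.

Lemma sqn_complete_equiv :
  (forall x, sqn a' x <= c2 * sqn a x) -> sqn_complete a -> sqn_complete a'.
Proof.
move=> le2 ca u uC; have [|l hl] := ca u.
  move=> eps e0; have [N hN] := uC _ (mulr_gt0 c1_gt0 e0).
  exists N => m n hm hn; rewrite -(ltr_pM2l c1_gt0).
  exact: le_lt_trans (le1 _) (hN m n hm hn).
exists l => eps e0; have c20 : 0 < `|c2| + 1 by have := normr_ge0 c2; lra.
have [N hN] := hl _ (divr_gt0 e0 c20); exists N => n /hN.
rewrite ltr_pdivlMr // => h; apply: le_lt_trans (le2 _) _; apply: le_lt_trans h.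
rewrite mulrC ler_wpM2l ?(sqn_ge0 ha) //.
by have := ler_norm c2; lra.
Qed.

End EquivalentForms.

(* The one-step extensions lose an arbitrarily small amount [c' - c]; the bounds
   [c * (2 - 1 / (n + 1))] keep the total loss finite. *)
Lemma iterate_with_slack (R : realType) (A : Type) (P : R -> A -> Prop)
    (Q : A -> A -> Prop) (c : R) (z0 : A) :
  0 < c -> P c z0 -> (forall c' c'' z, c' <= c'' -> P c' z -> P c'' z) ->
  (forall c' c'' z, 0 < c' < c'' -> P c' z -> exists z', P c'' z' /\ Q z z') ->
  exists u : nat -> A, forall n, P (2 * c) (u n) /\ Q (u n) (u n.+1).
Proof.
move=> c0 P0 Pmono step.
pose d n : R := c * (2 - n.+1%:R^-1).
have dlt n : 0 < d n < d n.+1.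
  have h : n.+2%:R^-1 < n.+1%:R^-1 :> R by rewrite ltf_pV2 ?posrE ?ltr0Sn // ltr_nat.
  have h1 : n.+1%:R^-1 <= 1 :> R by rewrite invf_le1 ?ltr0Sn // ler1n.
  move: h h1; rewrite /d; move: (n.+2%:R^-1) (n.+1%:R^-1) => s t h h1.
  by rewrite ltr_pM2l // pmulr_rgt0 //; lra.
(* The step must be total: where [P] fails, [z] itself is returned. The index travels along because
   the bound [d n] depends on it. *)
have /choice[F hF] : forall p : nat * A, exists z',
    P (d p.1) p.2 -> P (d p.1.+1) z' /\ Q p.2 z'.
  move=> [n z] /=; have [h|h] := pselect (P (d n) z); last by exists z.
  by have [z' hz'] := step _ _ _ (dlt n) h; exists z'.
pose u := fix u n := if n is m.+1 then F (m, u m) else z0.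
have uP n : P (d n) (u n).
  elim: n => [|n /(hF (n, u n))[]] //.
  by rewrite /d /= invr1 (_ : _ * _ = c) //; ring.
exists u => n; split; last by have [] := hF (n, u n) (uP n).
apply: Pmono (uP n); rewrite mulrC /d ler_wpM2l ?(ltW c0) //.
by rewrite gerBl invr_ge0.
Qed.

(** * One-step extensions in a norm for which the block operator is a contraction *)

Section Splitting.
Variables (R : realType) (K H : lmodType R[i]).
Variables (ipK : K -> K -> R[i]) (ipH : H -> H -> R[i]).
Hypotheses (hK : hermitian_form ipK) (cK : sqn_complete ipK).
Hypothesis dK : forall x, ipK x x = 0 -> x = 0.
Hypotheses (hH : hermitian_form ipH) (cH : sqn_complete ipH).
Hypothesis dH : forall x, ipH x x = 0 -> x = 0.
Variables (T : {linear K -> K}) (X : {linear H -> K}) (V : {linear H -> H}).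
Variables (e : (K * H)%type -> (K * H)%type -> R[i]) (c1 c2 : R).
Hypotheses (he : hermitian_form e) (c1_gt0 : 0 < c1).
Hypothesis le1 : forall z, c1 * (sqn ipK z.1 + sqn ipH z.2) <= sqn e z.
Hypothesis le2 : forall z, sqn e z <= c2 * (sqn ipK z.1 + sqn ipH z.2).
Hypothesis e_contr : forall z, sqn e (block_op T X V z) <= sqn e z.

Let pair_split (k : K) (h : H) : (k, h) = (k, 0) + (0, h) :> K * H.
Proof. by congr (_, _); rewrite /= ?addr0 ?add0r. Qed.

Let inlP c (k k' : K) : (c *: k + k', 0) = c *: (k, 0) + (k', 0) :> K * H.
Proof. by congr (_, _); rewrite /= scaler0 addr0. Qed.

Let inrP c (h h' : H) : (0, c *: h + h') = c *: (0, h) + (0, h') :> K * H.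
Proof. by congr (_, _); rewrite /= scaler0 addr0. Qed.

Let le1K k : c1 * sqn ipK k <= sqn e (k, 0).
Proof. by have := le1 (k, 0); rewrite /= (sqn0 hH) addr0. Qed.

Let le2K k : sqn e (k, 0) <= c2 * sqn ipK k.
Proof. by have := le2 (k, 0); rewrite /= (sqn0 hH) addr0. Qed.

(** Riesz on [K] for the restricted form [eK]. The vector [(m h, h)] is the [e]-shortest one above
    [h], from which all other lifts are measured. *)
Lemma orthogonal_section : exists m : {linear H -> K}, forall h k, e (m h, h) (k, 0) = 0.
Proof.
pose eK (k k' : K) := e (k, 0) (k', 0).
have heK : hermitian_form eK.
  split; rewrite /eK.
  - by move=> c x y z; rewrite inlP (hformDl he) (hformZl he).
  - by move=> x y; rewrite (hformC he).
  - by move=> x; case: he.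
have [|||||m hm] := @riesz_operator R K eK heK _ _ H (fun h k => - e (0, h) (k, 0)).
- exact: sqn_complete_equiv hK c1_gt0 le1K le2K cK.
- exact: definite_equiv hK c1_gt0 le1K dK.
- by move=> c z z' x; rewrite inrP (hformDl he) (hformZl he); ring.
- by move=> z c x y; rewrite inlP (hformDr he) (hformZr he); ring.
- move=> z; exists (sqn e (0, z)) => x; rewrite -(hformNl he).
  by apply: le_trans (form_cauchy_schwarz he _ _) _; rewrite (sqnN he).
exists m => h k; rewrite pair_split (hformDl he).
by have := hm h k; rewrite /eK => ->; rewrite addNr.
Qed.

(** On the range of [V], the graph of [Z'] must be the image under [R(X)] of the graph of [Z]. For
    general [h], the deviation from the minimal lift is copied from the [G]-projection [V (l h)] of
    [h]. The gap [c < c'] makes [G] coercive, so that this projection exists. *)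
Lemma lift_step (c c' : R) (Z : {linear H -> K}) :
  (forall h, sqn ipH (V h) = sqn ipH h) -> 0 < c < c' ->
  (forall h, sqn e (Z h, h) <= c * sqn ipH h) ->
  exists Z' : {linear H -> K}, (forall h, sqn e (Z' h, h) <= c' * sqn ipH h) /\
    forall h, Z' (V h) = T (Z h) + X h.
Proof.
move=> isoV /andP[c0 cc'] Zc; have [m hm] := orthogonal_section.
have mP d x y : (m (d *: x + y), d *: x + y) = d *: (m x, x) + (m y, y) :> K * H.
  by congr (_, _); rewrite /= linearP.
have em x k : sqn e (m x + k, x) = sqn e (m x, x) + sqn e (k, 0).
  rewrite -(sqnD_orth he (hm x k)); congr (sqn e (_, _)).
  by rewrite /= addr0.
have mc x : sqn e (m x, x) <= c * sqn ipH x.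
  apply: le_trans (Zc x); rewrite -[Z x](subrKC (m x)) em lerDl.
  exact: sqn_ge0.
(* Defect form: since [m x] is the minimal lift of [x], the room left for the component in [K]. *)
pose G (x y : H) := c'%:C%C * ipH x y - e (m x, x) (m y, y).
have sG x : sqn G x = c' * sqn ipH x - sqn e (m x, x).
  by rewrite /G {1}/sqn raddfB /= (sqnE hH) /= mul0r subr0.
have Gge x : (c' - c) * sqn ipH x <= sqn G x by rewrite sG; have := mc x; lra.
have hG : hermitian_form G.
  split; rewrite /G.
  - by move=> d x y z; rewrite mP !(hformDl he) !(hformZl he) !(hformDl hH) !(hformZl hH); ring.
  - move=> x y; rewrite (hformC he) (hformC hH) rmorphB rmorphM /=; congr (_ * _ - _).
    by apply/eqP; rewrite eq_complex /= oppr0 !eqxx.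
  - move=> x; rewrite -/(G x x) lecE /=; apply/andP; split.
      by rewrite /G (sqnE hH) (sqnE he) /= !mul0r mulr0 addr0 subr0.
    by apply: le_trans (Gge x); rewrite mulr_ge0 ?(sqn_ge0 hH) //; lra.
pose GV (x y : H) := G (V x) (V y).
have hGV : hermitian_form GV.
  split; rewrite /GV.
  - by move=> d x y z; rewrite linearP (hformDl hG) (hformZl hG).
  - by move=> x y; rewrite (hformC hG).
  - by move=> x; case: hG.
have cc0 : 0 < c' - c by lra.
have GVge x : (c' - c) * sqn ipH x <= sqn GV x by rewrite -isoV; exact: Gge.
have dGV := definite_equiv hH cc0 GVge dH.
(* [V (l x)] is the [G]-orthogonal projection of [x] onto the range of [V]. *)
have [||||l hl] := @riesz_operator R H GV hGV _ dGV H (fun x h => G x (V h)).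
- apply: (@sqn_complete_equiv R H ipH GV _ c' hH cc0 GVge _ cH) => x.
  by rewrite -[sqn GV x]/(sqn G (V x)) sG isoV gerBl (sqn_ge0 he).
- by move=> d z z' x; rewrite (hformDl hG) (hformZl hG).
- by move=> z d x y; rewrite linearP (hformDr hG) (hformZr hG).
- by move=> z; exists (sqn G z) => x; exact: (form_cauchy_schwarz hG).
have lV h : l (V h) = h by apply: (form_ext hGV dGV) => k; rewrite hl.
(* [w x] is how far [R(X) (Z (l x), l x)] lies from the minimal lift of [V (l x)]. *)
pose w := fun x => T (Z (l x)) + X (l x) - m (V (l x)).
exists (m \+ (((T \o Z) \+ X \- (m \o V)) \o l)); split=> /= h; last first.
  by rewrite lV subrKC.
rewrite -/(w h) em.
have h1 : sqn e (m (V (l h)), V (l h)) + sqn e (w h, 0) <= c * sqn ipH (l h).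
  rewrite -em /w subrKC; apply: le_trans (Zc _).
  exact: le_trans (e_contr (Z (l h), l h)).
(* A [G]-orthogonal projection does not increase [G]. With [h1], [sqn e (w h, 0) <= sqn G (V (l h))
   <= sqn G h], the room left above [m h]. *)
have h2 : sqn G (V (l h)) <= sqn G h.
  have o : G (V (l h)) (h - V (l h)) = 0.
    by rewrite (hformC hG) (hformBl hG) -hl subrr conjC0.
  by rewrite -[X in _ <= sqn G X](subrKC (V (l h))) (sqnD_orth hG o) lerDl (sqn_ge0 hG).
move: h2; rewrite !sG isoV => h2.
have := sqn_ge0 hH (l h) => h3.
have : c * sqn ipH (l h) <= c' * sqn ipH (l h) by rewrite ler_wpM2r // ltW.
lra.
Qed.

(** The map [rho (k, h) = k - Z' h] must satisfy [T rho = r] and [rho (k, 0) = k]. The first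
    condition fixes its component [Tst (r z)]; its component in the kernel of [T] is transported
    from [K] by the [G]-orthogonal projection [l]. *)
Lemma extension_step (Tst : {linear K -> K}) (c c' : R) (Z : {linear H -> K}) :
  (forall x y, ipK (T x) y = ipK x (Tst y)) -> (forall k, T (Tst k) = k) ->
  0 < c < c' ->
  (forall k h, sqn ipK (k - Z h) <= c * sqn e (k, h)) ->
  exists Z' : {linear H -> K}, (forall k h, sqn ipK (k - Z' h) <= c' * sqn e (k, h)) /\
    forall h, Z (V h) = T (Z' h) + X h.
Proof.
move=> adjT TTst /andP[c0 cc'] Zc; have cc0 : 0 < c' - c by lra.
(* [r] is the old map [(k, h) |-> k - Z h] applied after [R(X)]; [G] below measures its defect
   against [c']. *)
pose r : {linear (K * H)%type -> K} := ((T \o fst) \+ ((X \- (Z \o V)) \o snd)).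
have rE z : r z = T z.1 + (X z.2 - Z (V z.2)) by [].
clearbody r.
have rc z : sqn ipK (r z) <= c * sqn e z.
  rewrite rE addrA; apply: le_trans (Zc _ _) _.
  by rewrite ler_wpM2l ?(ltW c0) //; exact: e_contr.
pose G z w := c'%:C%C * e z w - ipK (r z) (r w).
have sG z : sqn G z = c' * sqn e z - sqn ipK (r z).
  by rewrite /G {1}/sqn raddfB /= (sqnE he) /= mul0r subr0.
have Gge z : (c' - c) * sqn e z <= sqn G z by rewrite sG; have := rc z; lra.
have hG : hermitian_form G.
  split; rewrite /G.
  - by move=> d x y z; rewrite (linearP r) !(hformDl he) !(hformZl he) !(hformDl hK) !(hformZl hK); ring.
  - move=> x y; rewrite (hformC he) (hformC hK) rmorphB rmorphM /=; congr (_ * _ - _).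
    by apply/eqP; rewrite eq_complex /= oppr0 !eqxx.
  - move=> x; rewrite -/(G x x) lecE /=; apply/andP; split.
      by rewrite /G (sqnE hK) (sqnE he) /= !mul0r mulr0 addr0 subr0.
    by apply: le_trans (Gge x); rewrite mulr_ge0 ?(sqn_ge0 he) //; lra.
pose GK (k k' : K) := G (k, 0) (k', 0).
have hGK : hermitian_form GK.
  split; rewrite /GK.
  - by move=> d x y z; rewrite inlP (hformDl hG) (hformZl hG).
  - by move=> x y; rewrite (hformC hG).
  - by move=> x; case: hG.
have c3 : 0 < (c' - c) * c1 by rewrite mulr_gt0.
have GKge k : (c' - c) * c1 * sqn ipK k <= sqn GK k.
  apply: le_trans (Gge (k, 0)); rewrite -mulrA ler_wpM2l ?(ltW cc0) //; exact: le1K.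
have dGK := definite_equiv hK c3 GKge dK.
(* [(l z, 0)] is the [G]-orthogonal projection of [z] onto [K]. *)
have [||||l hl] := @riesz_operator R K GK hGK _ dGK (K * H)%type (fun z k => G z (k, 0)).
- apply: (@sqn_complete_equiv R K ipK GK _ (c' * c2) hK c3 GKge _ cK) => k.
  rewrite -[sqn GK k]/(sqn G (k, 0)) sG -mulrA.
  have : c' * sqn e (k, 0) <= c' * (c2 * sqn ipK k) by rewrite ler_wpM2l ?le2K //; lra.
  by have := sqn_ge0 hK (r (k, 0)); lra.
- by move=> d z z' x; rewrite (hformDl hG) (hformZl hG).
- by move=> z d x y; rewrite inlP (hformDr hG) (hformZr hG).
- by move=> z; exists (sqn G z) => x; exact: (form_cauchy_schwarz hG).
have lK k : l (k, 0) = k by apply: (form_ext hGK dGK) => k'; rewrite hl.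
have rK k : r (k, 0) = T k by rewrite rE /= !linear0 !addr0.
pose rho : {linear (K * H)%type -> K} := (Tst \o r) \+ (l \- (Tst \o (T \o l))).
have rhoE z : rho z = Tst (r z) + (l z - Tst (T (l z))) by [].
clearbody rho.
have rhoK k : rho (k, 0) = k by rewrite rhoE rK lK subrKC.
have Zl : linear (fun h => - rho (0, h)).
  by move=> d x y; rewrite inrP linearP opprD scalerN.
have [Z' Z'E] := linear_map_of Zl.
have rhoB k h : k - - rho (0, h) = rho (k, h).
  by rewrite opprK -{1}[k]rhoK -linearD -pair_split.
exists Z'; split=> [k h|h]; rewrite Z'E; last first.
  by rewrite linearN rhoE linearD linearB !TTst subrr addr0 rE /= linear0 add0r opprB subrK.
rewrite rhoB; move: (k, h) => z {k h}.
(* The two parts of [rho z] are orthogonal: one lies in the range of [Tst], the other is killed by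
   [T]. *)
have o : ipK (Tst (r z)) (l z - Tst (T (l z))) = 0.
  by rewrite (hformC hK) -adjT linearB TTst subrr (hform0l hK) conjC0.
have o' : ipK (Tst (T (l z))) (l z - Tst (T (l z))) = 0.
  by rewrite (hformC hK) -adjT linearB TTst subrr (hform0l hK) conjC0.
have sT x : sqn ipK (Tst x) = sqn ipK x by rewrite /sqn -adjT TTst.
rewrite rhoE (sqnD_orth hK o) sT.
have h1 : sqn ipK (l z) = sqn ipK (T (l z)) + sqn ipK (l z - Tst (T (l z))).
  by rewrite -[in LHS](subrKC (Tst (T (l z))) (l z)) (sqnD_orth hK o') sT.
have h2 : sqn ipK (l z) <= c * sqn e (l z, 0).
  by have := Zc (l z) 0; rewrite linear0 subr0.
(* By [h1] and [h2], [sqn G (l z, 0)] dominates the kernel part of [rho z]. *)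
have h3 : sqn G (l z, 0) <= sqn G z.
  have o3 : G (l z, 0) (z - (l z, 0)) = 0.
    by rewrite (hformC hG) (hformBl hG) -hl subrr conjC0.
  by rewrite -[X in _ <= sqn G X](subrKC (l z, 0)) (sqnD_orth hG o3) lerDl (sqn_ge0 hG).
move: h3; rewrite !sG rK => h3.
have : c * sqn e (l z, 0) <= c' * sqn e (l z, 0).
  by rewrite ler_wpM2r ?(ltW cc') ?(sqn_ge0 he).
lra.
Qed.

Let splits Z := exists M, (forall h, sqn ipK (Z h) <= M * sqn ipH h) /\
  forall h, Z (V h) = T (Z h) + X h.

(** The iteration of [lift_step] starts from [Z = 0], admissible by [le2]; [le1] turns the
    [e]-bounds into bounds on the iterates. *)
Lemma splitting_of_isometry (Tst : {linear K -> K}) :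
  (forall x y, ipK (T x) y = ipK x (Tst y)) ->
  (forall h, sqn ipH (V h) = sqn ipH h) -> exists Z : {linear H -> K}, splits Z.
Proof.
move=> adjT isoV; pose c := `|c2| + 1.
have c0 : 0 < c by rewrite /c; have := normr_ge0 c2; lra.
have [|d d' Z h1 h2 h|d d' Z h0 h|u hu] := @iterate_with_slack R {linear H -> K}
    (fun d Z => forall h, sqn e (Z h, h) <= d * sqn ipH h)
    (fun Z Z' => forall h, Z' (V h) = T (Z h) + X h) c \0 c0.
- move=> h /=; apply: le_trans (le2 _) _; rewrite /= (sqn0 hK) add0r.
  rewrite ler_wpM2r ?(sqn_ge0 hH) // /c; have := ler_norm c2; lra.
- by apply: le_trans (h2 h) _; rewrite ler_wpM2r ?(sqn_ge0 hH).
- exact: lift_step isoV h0 h.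
have [|n h|Z [ZM ZV]] := @intertwiner_of_bounded_sequence R K H ipK ipH hK cK dK
    T Tst X V u (2 * c / c1) 1 0 adjT.
- move=> n h; rewrite mulrAC ler_pdivlMr // mulrC.
  apply: le_trans ((hu n).1 h); apply: le_trans (le1 _); rewrite /= ler_wpM2l ?(ltW c1_gt0) //.
  by rewrite lerDl (sqn_ge0 hH).
- by rewrite addn1 addn0 (hu n).2.
by exists Z, (2 * c / c1).
Qed.

(** The iteration of [extension_step] starts from [Z = 0], admissible by [le1]; taking [k = 0],
    [le2] bounds the iterates. *)
Lemma splitting_of_coisometry (Tst : {linear K -> K}) :
  (forall x y, ipK (T x) y = ipK x (Tst y)) -> (forall k, T (Tst k) = k) ->
  exists Z : {linear H -> K}, splits Z.
Proof.
move=> adjT TTst; have c0 : 0 < c1^-1 by rewrite invr_gt0.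
have [|d d' Z h1 h2 k h|d d' Z h0 h|u hu] := @iterate_with_slack R {linear H -> K}
    (fun d Z => forall k h, sqn ipK (k - Z h) <= d * sqn e (k, h))
    (fun Z Z' => forall h, Z (V h) = T (Z' h) + X h) c1^-1 \0 c0.
- move=> k h /=; rewrite subr0 mulrC ler_pdivlMr // mulrC; apply: le_trans (le1 _).
  by rewrite /= ler_wpM2l ?(ltW c1_gt0) // lerDl (sqn_ge0 hH).
- by apply: le_trans (h2 k h) _; rewrite ler_wpM2r ?(sqn_ge0 he).
- exact: extension_step adjT TTst h0 h.
have [|n h|Z [ZM ZV]] := @intertwiner_of_bounded_sequence R K H ipK ipH hK cK dK
    T Tst X V u (2 / c1 * c2) 0 1 adjT.
- move=> n h; have := (hu n).1 0 h; rewrite sub0r (sqnN hK) => h1; apply: le_trans h1 _.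
  rewrite -[leRHS]mulrA ler_wpM2l ?mulr_ge0 ?(ltW c0) //.
  by have := le2 (0, h); rewrite /= (sqn0 hK) add0r.
- by rewrite addn1 addn0 (hu n).2.
by exists Z, (2 / c1 * c2).
Qed.

End Splitting.

(** * Similarity to a contraction *)

Section HilbertNorm.
Variables (R : realType) (U W : lmodType R[i]).
Variables (ipU : U -> U -> R[i]) (ipW : W -> W -> R[i]).
Hypotheses (hU : hermitian_form ipU) (hW : hermitian_form ipW).

Lemma hnormE (E : lmodType R[i]) (a : E -> E -> R[i]) x :
  hermitian_form a -> hnorm a x = (Num.sqrt (sqn a x))%:C%C.
Proof.
move=> ha; rewrite /hnorm (sqnE ha) -{1}(sqr_sqrtr (sqn_ge0 ha x)) rmorphXn /=.
by rewrite sqrCK // ler0c sqrtr_ge0.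
Qed.

Lemma hnorm_le x y : (hnorm ipU x <= hnorm ipW y) = (sqn ipU x <= sqn ipW y).
Proof. by rewrite !hnormE // lecR ler_sqrt // sqn_ge0. Qed.

Lemma hnorm_leM (c : R) x y : sqn ipW y <= c * sqn ipU x ->
  hnorm ipW y <= (Num.sqrt `|c|)%:C%C * hnorm ipU x.
Proof.
move=> h; rewrite !hnormE // -rmorphM lecR -sqrtrM // ler_wsqrtr //.
by apply: le_trans h _; rewrite ler_wpM2r ?(sqn_ge0 hU) // ler_norm.
Qed.

(** An inequality in the complex order compares real parts, so [Re M] serves as the constant. *)
Lemma sqn_leM (M : R[i]) x y : hnorm ipW y <= M * hnorm ipU x ->
  sqn ipW y <= complex.Re M ^+ 2 * sqn ipU x.
Proof.
rewrite !hnormE //; case: M => p q; rewrite lecE /= => /andP[_].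
rewrite mulr0 subr0 => h.
rewrite -(sqr_sqrtr (sqn_ge0 hU x)) -(sqr_sqrtr (sqn_ge0 hW y)) -exprMn.
by rewrite lerXn2r ?nnegrE ?sqrtr_ge0 // (le_trans _ h) ?sqrtr_ge0.
Qed.

Lemma bounded_opP (f : U -> W) : bounded_op (hnorm ipU) (hnorm ipW) f <->
  exists c : R, 0 <= c /\ forall x, sqn ipW (f x) <= c * sqn ipU x.
Proof.
split=> [[M h]|[c [_ h]]].
  by exists (complex.Re M ^+ 2); split=> [|x]; [exact: sqr_ge0|exact: sqn_leM].
by exists (Num.sqrt `|c|)%:C%C => x; exact: hnorm_leM.
Qed.

End HilbertNorm.

Section HilbertSpace.
Variables (R : realType) (E : lmodType R[i]) (a : E -> E -> R[i]).
Hypothesis ha : is_hilbert a.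

Lemma hilbert_hermitian : hermitian_form a.
Proof. by case: ha. Qed.

Lemma hilbert_definite x : a x x = 0 -> x = 0.
Proof. by case: ha => _ _ _ h _; apply: h. Qed.

Lemma hilbert_complete : sqn_complete a.
Proof.
have hf := hilbert_hermitian; case: ha => _ _ _ _ h u uC; have [|l hl] := h u.
  case=> p q; rewrite ltcE /= => /andP[/eqP -> p0].
  have [N hN] := uC _ (exprn_gt0 2 p0); exists N => m n hm hn.
  rewrite hnormE // ltcR -(ltr_pXn2r (n := 2)) ?nnegrE ?sqrtr_ge0 ?(ltW p0) //.
  by rewrite sqr_sqrtr ?(sqn_ge0 hf) //; exact: hN.
exists l => eps e0; have : 0 < (Num.sqrt eps)%:C%C :> R[i] by rewrite ltcR sqrtr_gt0.
move=> /hl[N hN]; exists N => n /hN.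
by rewrite hnormE // ltcR ltr_sqrt.
Qed.

End HilbertSpace.

(** * Adjoints of isometries and coisometries *)

Section Adjoint.
Variables (R : realType) (U W : lmodType R[i]).
Variables (ipU : U -> U -> R[i]) (ipW : W -> W -> R[i]).
Hypotheses (hU : hermitian_form ipU) (hW : hermitian_form ipW).
Variables (T : {linear U -> W}) (Tst : {linear W -> U}).
Hypothesis adjT : is_adjoint ipU ipW T Tst.

Lemma adjoint_sym : is_adjoint ipW ipU Tst T.
Proof. by move=> x y; rewrite (hformC hU) -adjT -(hformC hW). Qed.

Lemma sqn_coisometry_adjoint : (forall y, T (Tst y) = y) ->
  forall y, sqn ipU (Tst y) = sqn ipW y.
Proof. by move=> h y; rewrite /sqn -adjT h. Qed.

(** [Tst T] is an orthogonal projection, and [Tst] preserves norms. *)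
Lemma sqn_coisometry_le : (forall y, T (Tst y) = y) ->
  forall x, sqn ipW (T x) <= sqn ipU x.
Proof.
move=> h x; rewrite -(sqn_coisometry_adjoint h).
have o : ipU (Tst (T x)) (x - Tst (T x)) = 0.
  by rewrite (hformC hU) -adjT linearB h subrr (hform0l hW) conjC0.
by rewrite -[X in _ <= sqn _ X](subrKC (Tst (T x))) (sqnD_orth hU o) lerDl (sqn_ge0 hU).
Qed.

(** Polarisation gives the real parts of the inner products; [Re_linear_inj] recovers the rest. *)
Lemma isometry_adjointK : (forall x, ipU x x = 0 -> x = 0) ->
  (forall x, sqn ipW (T x) = sqn ipU x) -> forall x, Tst (T x) = x.
Proof.
move=> dU iso x; apply: (form_ext hU dU) => k.
have polar y : complex.Re (ipW (T y) (T k)) = complex.Re (ipU y k).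
  have := iso (y + k); rewrite linearD (sqnD hU) (sqnD hW) !iso; lra.
rewrite adjoint_sym; apply/eqP; rewrite -subr_eq0; apply/eqP.
apply: (@Re_linear_inj R U (fun x => ipW (T x) (T k) - ipU x k)) => [c y|y].
  by rewrite linearZ (hformZl hW) (hformZl hU) mulrBr.
by rewrite raddfB /= polar subrr.
Qed.

End Adjoint.

(** * Shears and equivalent Hilbert norms *)

Section Similarity.
Variables (R : realType) (K H : lmodType R[i]).
Variables (ipK : K -> K -> R[i]) (ipH : H -> H -> R[i]).
Hypotheses (hK : hermitian_form ipK) (hH : hermitian_form ipH).
Variables (T : {linear K -> K}) (X : {linear H -> K}) (V : {linear H -> H}).

Let ipE (z w : K * H) := ipK z.1 w.1 + ipH z.2 w.2.

Let hE : hermitian_form ipE.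
Proof.
split; rewrite /ipE.
- move=> c x y z /=; rewrite (hformDl hK) (hformZl hK) (hformDl hH) (hformZl hH); ring.
- by move=> x y; rewrite (hformC hK) (hformC hH) rmorphD.
- by case: hK hH => _ _ h [_ _ h'] x; rewrite addr_ge0.
Qed.

Let sE z : sqn ipE z = sqn ipK z.1 + sqn ipH z.2.
Proof. by rewrite /sqn raddfD. Qed.

(** The shear [(k, h) |-> (k + Z h, h)] turns the off-diagonal entry into [T Z + X - Z V = 0],
    leaving the diagonal contraction. *)
Lemma similar_of_splitting (Z : {linear H -> K}) (M : R) :
  (forall k, sqn ipK (T k) <= sqn ipK k) -> (forall h, sqn ipH (V h) <= sqn ipH h) ->
  (forall h, sqn ipK (Z h) <= M * sqn ipH h) ->
  (forall h, Z (V h) = T (Z h) + X h) ->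
  similar_to_contraction (sum_norm ipK ipH) (block_op T X V).
Proof.
move=> Tc Vc ZM ZV.
have shear (Y : {linear H -> K}) : linear (fun z : K * H => (z.1 + Y z.2, z.2)).
  move=> c x y; apply: injective_projections => //=.
  by rewrite linearP scalerDr addrACA.
have shearM (Y : {linear H -> K}) : (forall h, sqn ipK (Y h) <= M * sqn ipH h) ->
    forall z : K * H, sqn ipE (z.1 + Y z.2, z.2) <= (2 * `|M| + 2) * sqn ipE z.
  move=> YM z; rewrite !sE /=.
  have := sqnD_le hK z.1 (Y z.2); have := YM z.2.
  have := sqn_ge0 hK z.1; have := sqn_ge0 hH z.2.
  have := normr_ge0 M; have := ler_norm M.
  move: (sqn ipH z.2) (sqn ipK z.1) `|M| => s t m h1 h2 h3 h4 h5 h6.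
  have : M * s <= m * s by rewrite ler_wpM2r.
  have : 0 <= m * t by rewrite mulr_ge0.
  lra.
have [L LE] := linear_map_of (shear Z).
have [L' L'E] := linear_map_of (shear (\- Z)).
exists L, L'; split.
- apply/(bounded_opP hE hE); exists (2 * `|M| + 2); split=> [|z].
    by have := normr_ge0 M; lra.
  by rewrite LE; exact: shearM.
- apply/(bounded_opP hE hE); exists (2 * `|M| + 2); split=> [|z].
    by have := normr_ge0 M; lra.
  by rewrite L'E; apply: shearM => h; rewrite /= (sqnN hK).
- by move=> z; rewrite LE L'E /= addrK; case: z.
- by move=> z; rewrite LE L'E /= subrK; case: z.
- move=> z; rewrite -[sum_norm _ _]/(hnorm ipE) (hnorm_le hE hE) !sE LE L'E /=.
  by rewrite linearD -(addrA (T z.1)) -ZV addrK lerD.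
Qed.

(** [e] is the inner product pulled back by the inverse of [L]. The bound of [L] gives [c1], that of
    its inverse gives [c2]. *)
Lemma similarity_form :
  similar_to_contraction (sum_norm ipK ipH) (block_op T X V) ->
  exists (e : K * H -> K * H -> R[i]) (c1 c2 : R),
    [/\ hermitian_form e, 0 < c1,
        forall z, c1 * (sqn ipK z.1 + sqn ipH z.2) <= sqn e z,
        forall z, sqn e z <= c2 * (sqn ipK z.1 + sqn ipH z.2) &
        forall z, sqn e (block_op T X V z) <= sqn e z].
Proof.
move=> [L [L' [/(bounded_opP hE hE)[d [d0 Ld]] /(bounded_opP hE hE)[d' [_ L'd]] LK L'K LR]]].
exists (fun z w => ipE (L' z) (L' w)), (d + 1)^-1, d'; split.
- split; first by move=> c x y z; rewrite linearP (hformDl hE) (hformZl hE).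
    by move=> x y; rewrite (hformC hE).
  by move=> x; case: hE.
- by rewrite invr_gt0; lra.
- move=> z; rewrite -sE mulrC ler_pdivrMr; last by lra.
  have := Ld (L' z); rewrite L'K mulrC -/(sqn ipE (L' z)) => h.
  apply: le_trans h _; rewrite -[X in _ <= X * _]/(sqn ipE (L' z)).
  by rewrite ler_wpM2l ?(sqn_ge0 hE) //; lra.
- by move=> z; rewrite -sE; exact: L'd.
- move=> z; have := LR (L' z); rewrite L'K.
  by rewrite -[sum_norm _ _]/(hnorm ipE) (hnorm_le hE hE).
Qed.

End Similarity.

(** * Telescoping sums and the two equivalences *)

Lemma sum_telescope (R : realType) (E : lmodType R[i]) (f g : nat -> E) n :
  (forall j, g j = f j - f j.+1) -> \sum_(j < n) g j = f 0%N - f n.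
Proof.
move=> h; elim: n => [|n IH]; first by rewrite big_ord0 subrr.
by rewrite big_ord_recr /= IH h subrKA.
Qed.

Lemma iter_linearB (R : realType) (E : lmodType R[i]) (T : {linear E -> E}) j x y :
  iter j T (x - y) = iter j T x - iter j T y.
Proof. by elim: j => //= j ->; rewrite linearB. Qed.

Lemma sqn_iter_le (R : realType) (E : lmodType R[i]) (a : E -> E -> R[i]) (T : E -> E) j x :
  (forall y, sqn a (T y) <= sqn a y) -> sqn a (iter j T x) <= sqn a x.
Proof. by move=> h; elim: j => //= j IH; apply: le_trans (h _) IH. Qed.

Section Necessity.
Variables (R : realType) (K H : lmodType R[i]).
Variables (ipK : K -> K -> R[i]) (ipH : H -> H -> R[i]).
Hypotheses (hK : hermitian_form ipK) (hH : hermitian_form ipH).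
Variables (P : {linear K -> K}) (Q : {linear H -> H}) (Z : {linear H -> K}) (M : R).
Hypothesis Pc : forall k, sqn ipK (P k) <= sqn ipK k.
Hypothesis Qc : forall h, sqn ipH (Q h) <= sqn ipH h.
Hypothesis ZM : forall h, sqn ipK (Z h) <= M * sqn ipH h.

(** Up to sign, the telescoped sums are such differences: [P = T], [Q = Vst] in (a), [P = Tst],
    [Q = V] in (b). Contractivity makes the bound independent of [n]. *)
Lemma iter_difference_bounded : exists C : R[i], forall (n : nat) h,
  hnorm ipK (Z h - iter n P (Z (iter n Q h))) <= C * hnorm ipH h.
Proof.
exists (Num.sqrt `|4 * `|M| |)%:C%C => n h; apply: (hnorm_leM hH hK).
apply: le_trans (sqnB_le hK _ _) _.
have ZM' x : sqn ipK (Z x) <= `|M| * sqn ipH x.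
  by apply: le_trans (ZM x) _; rewrite ler_wpM2r ?(sqn_ge0 hH) // ler_norm.
have := ZM' h; have : sqn ipK (iter n P (Z (iter n Q h))) <= `|M| * sqn ipH h.
  apply: le_trans (sqn_iter_le _ _ Pc) _; apply: le_trans (ZM' _) _.
  by rewrite ler_wpM2l // sqn_iter_le.
lra.
Qed.

End Necessity.

Theorem theorem2p4 (R : realType) (K H : lmodType R[i])
  (ipK : K -> K -> R[i]) (ipH : H -> H -> R[i])
  (hK : is_hilbert ipK) (hH : is_hilbert ipH)
  (X : {linear H -> K}) (T Tst : {linear K -> K}) (V Vst : {linear H -> H})
  (bX : bounded_op (hnorm ipH) (hnorm ipK) X)
  (bT : bounded_op (hnorm ipK) (hnorm ipK) T)
  (bV : bounded_op (hnorm ipH) (hnorm ipH) V)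
  (adjT : is_adjoint ipK ipK T Tst) (adjV : is_adjoint ipH ipH V Vst) :
  let RX := block_op T X V in
  let nE := sum_norm ipK ipH in
  (* (a) *)
  ((forall h : H, hnorm ipH (V h) = hnorm ipH h) ->
   (forall k : K, hnorm ipK (T k) <= hnorm ipK k) ->
   (exists S : {linear K -> K},
      bounded_op (hnorm ipK) (hnorm ipK) S /\ forall k : K, T (S k) = k) ->
   (similar_to_contraction nE RX <->
    exists A F : {linear H -> K},
      [/\ bounded_op (hnorm ipH) (hnorm ipK) A,
          bounded_op (hnorm ipH) (hnorm ipK) F,
          forall h : H, X h = A h + F h,
          exists M : R[i], forall (n : nat) (h : H),
            hnorm ipK (\sum_(j < n.+1) iter j T (A (iter j.+1 Vst h)))
              <= M * hnorm ipH h &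
          forall h : H, F (V h) = 0]))
  /\
  (* (b) *)
  ((forall k : K, T (Tst k) = k) ->
   (forall h : H, hnorm ipH (V h) <= hnorm ipH h) ->
   (exists S : {linear H -> H},
      bounded_op (hnorm ipH) (hnorm ipH) S /\ forall h : H, S (V h) = h) ->
   (similar_to_contraction nE RX <->
    exists A F : {linear H -> K},
      [/\ bounded_op (hnorm ipH) (hnorm ipK) A,
          bounded_op (hnorm ipH) (hnorm ipK) F,
          forall h : H, X h = A h + F h,
          exists M : R[i], forall (n : nat) (h : H),
            hnorm ipK (\sum_(j < n.+1) iter j.+1 Tst (A (iter j V h)))
              <= M * hnorm ipH h &
          forall h : H, T (F h) = 0])).
Proof.
move=> RX nE.
have fK := hilbert_hermitian hK; have fH := hilbert_hermitian hH.
have dK := hilbert_definite hK; have dH := hilbert_definite hH.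
have cK := hilbert_complete hK; have cH := hilbert_complete hH.
have bdP := bounded_opP fH fK.
have [tX [tX0 tXle]] := (bdP X).1 bX.
split.
- move=> isoV cT [S [bS TS]].
  have {}isoV h : sqn ipH (V h) = sqn ipH h.
    by apply/eqP; rewrite eq_le -!(hnorm_le fH fH) isoV lexx.
  have {}cT k : sqn ipK (T k) <= sqn ipK k by rewrite -(hnorm_le fK fK).
  have VstV h : Vst (V h) = h by apply: (isometry_adjointK fH fH adjV dH isoV).
  have cVst h : sqn ipH (Vst h) <= sqn ipH h.
    exact: (sqn_coisometry_le fH fH (adjoint_sym fH fH adjV) VstV).
  split=> [/(similarity_form fK fH)[e [c1 [c2 [he c10 le1 le2 eR]]]]|].
    have [Z [M [ZM ZV]]] := splitting_of_isometry fK cK dK fH cH dH he c10 le1 le2 eR adjT isoV.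
    (* [Z'] agrees with [Z] on the range of [V], and [Z' V Vst = Z'] makes the sums telescope. *)
    pose Z' : {linear H -> K} := Z \o (V \o Vst).
    have Z'M h : sqn ipK (Z' h) <= `|M| * sqn ipH h.
      apply: le_trans (ZM _) _; apply: le_trans (ler_wpM2r (sqn_ge0 fH _) (ler_norm M)) _.
      by rewrite ler_wpM2l // isoV.
    pose A : {linear H -> K} := (Z' \o V) \- (T \o Z').
    have bA : bounded_op (hnorm ipH) (hnorm ipK) A.
      apply/bdP; exists (4 * `|M|); split=> [|h]; first by rewrite mulr_ge0.
      have := sqnB_le fK (Z' (V h)) (T (Z' h)).
      by have := cT (Z' h); have := Z'M h; have := Z'M (V h); rewrite isoV /A /=; lra.
    exists A, (X \- A); split=> //.
    + apply/bdP; have [t [t0 At]] := (bdP A).1 bA.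
      exists (2 * tX + 2 * t); split=> [|h]; first by lra.
      rewrite -[leLHS]/(sqn ipK (X h - A h)).
      by have := sqnB_le fK (X h) (A h); have := At h; have := tXle h; lra.
    + by move=> h /=; rewrite subrKC.
    + have [C hC] := iter_difference_bounded fK fH cT cVst Z'M.
      exists C => n h.
      rewrite (_ : \sum_(j < n.+1) _ = Z' h - iter n.+1 T (Z' (iter n.+1 Vst h))).
        exact: hC n.+1 h.
      apply: (@sum_telescope R K (fun j => iter j T (Z' (iter j Vst h)))
        (fun j => iter j T (A (iter j.+1 Vst h)))) => j.
      by rewrite (iterSr j T) -iter_linearB /= VstV.
    (* [X = Z V - T Z] and [A] agree on the range of [V]. *)
    + by move=> h; rewrite /A /= !VstV (ZV (V h)) [_ + X _]addrC addrK subrr.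
  move=> [A [F [bA bF XE [C hC] FV]]].
  (* The sums become linear maps through [Y (n+1) = A Vst + T (Y n) Vst]. *)
  have sums n : exists Y : {linear H -> K}, forall h,
      Y h = \sum_(j < n.+1) iter j T (A (iter j.+1 Vst h)).
    elim: n => [|n [Y hY]].
      by exists (A \o Vst) => h; rewrite big_ord1.
    exists ((A \o Vst) \+ (T \o (Y \o Vst))) => h; rewrite big_ord_recl /= hY linear_sum.
    by congr (_ + _); apply: eq_bigr => j _; rewrite /= -!iterS -iterSr.
  have /choice[Y hY] := sums.
  have YM n h : sqn ipK (Y n h) <= complex.Re C ^+ 2 * sqn ipH h.
    by apply: (sqn_leM fH fK); rewrite hY.
  (* [Vst V = 1] gives [Y (n+1) V = T (Y n) + A], hence [W V = T W + A] in the limit. *)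
  have [|W [WM WV]] := @intertwiner_of_bounded_sequence _ _ _ _ ipH fK cK dK T Tst A V Y _ 1 0 adjT YM.
    move=> n h; rewrite addn1 addn0 !hY big_ord_recl /= VstV linear_sum addrC; congr (_ + _).
    apply: eq_bigr => j _; rewrite /= /bump /= add0n.
    by rewrite -[Vst (iter j Vst (V h))]/(iter j.+1 Vst (V h)) iterSr VstV.
  have [s [s0 Ss]] := (bounded_opP fK fK S).1 bS; have [t [t0 Ft]] := (bdP F).1 bF.
  (* [- S F] solves the equation for [F], since [F V = 0] and [T S = 1]. *)
  apply: (@similar_of_splitting _ _ _ _ _ fK fH T X V (W \- (S \o F)) (2 * complex.Re C ^+ 2 + 2 * (s * t))).
  + exact: cT.
  + by move=> h; rewrite isoV.
  + move=> h /=; have := sqnB_le fK (W h) (S (F h)); have := WM h; have := Ss (F h).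
    have : s * sqn ipK (F h) <= s * (t * sqn ipH h) by rewrite ler_wpM2l.
    lra.
  + move=> h /=; rewrite FV linear0 subr0 WV linearB TS XE.
    by rewrite [A h + _]addrC addrA subrK.
- move=> TTst cV [S [bS SV]].
  have {}cV h : sqn ipH (V h) <= sqn ipH h by rewrite -(hnorm_le fH fH).
  have cT : forall k, sqn ipK (T k) <= sqn ipK k := sqn_coisometry_le fK fK adjT TTst.
  have isoT := sqn_coisometry_adjoint adjT TTst.
  split=> [/(similarity_form fK fH)[e [c1 [c2 [he c10 le1 le2 eR]]]]|].
    have [Z [M [ZM ZV]]] := splitting_of_coisometry fK cK dK fH he c10 le1 le2 eR adjT TTst.
    (* Here [T Z' = T Z], and [Tst T Z' = Z'] makes the sums telescope. *)
    pose Z' : {linear H -> K} := Tst \o (T \o Z).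
    have Z'M h : sqn ipK (Z' h) <= `|M| * sqn ipH h.
      rewrite /= isoT; apply: le_trans (cT _) _; apply: le_trans (ZM _) _.
      by rewrite ler_wpM2r ?(sqn_ge0 fH) // ler_norm.
    pose A : {linear H -> K} := (Z' \o V) \- (T \o Z').
    have bA : bounded_op (hnorm ipH) (hnorm ipK) A.
      apply/bdP; exists (4 * `|M|); split=> [|h]; first by rewrite mulr_ge0.
      have := sqnB_le fK (Z' (V h)) (T (Z' h)).
      have := cT (Z' h); have := Z'M h; have := Z'M (V h).
      have : `|M| * sqn ipH (V h) <= `|M| * sqn ipH h by rewrite ler_wpM2l.
      by rewrite /A /=; lra.
    exists A, (X \- A); split=> //.
    + apply/bdP; have [t [t0 At]] := (bdP A).1 bA.
      exists (2 * tX + 2 * t); split=> [|h]; first by lra.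
      rewrite -[leLHS]/(sqn ipK (X h - A h)).
      by have := sqnB_le fK (X h) (A h); have := At h; have := tXle h; lra.
    + by move=> h /=; rewrite subrKC.
    + have cTst k : sqn ipK (Tst k) <= sqn ipK k by rewrite isoT.
      have [C hC] := iter_difference_bounded fK fH cTst cV Z'M.
      exists C => n h.
      (* The sign is opposite to part (a), hence the negated terms. *)
      rewrite (_ : \sum_(j < n.+1) _ = - Z' h - - iter n.+1 Tst (Z' (iter n.+1 V h))).
        by rewrite -opprD (hnormE _ fK) (sqnN fK) -(hnormE _ fK); exact: hC n.+1 h.
      apply: (@sum_telescope R K (fun j => - iter j Tst (Z' (iter j V h)))
        (fun j => iter j.+1 Tst (A (iter j V h)))) => j.
      by rewrite opprK addrC !iterSr -iter_linearB /A /= !linearB /= TTst -(iterSr j V).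
    (* [T A = T Z V - T T Z = T X], hence [T F = 0]. *)
    + move=> h; have XE : X h = Z (V h) - T (Z h) by rewrite ZV addrC addKr.
      by rewrite /A /= XE TTst opprB addrA subrK linearB TTst subrr.
  move=> [A [F [bA bF XE [C hC] TF]]].
  have sums n : exists Y : {linear H -> K}, forall h,
      Y h = \sum_(j < n.+1) iter j.+1 Tst (A (iter j V h)).
    elim: n => [|n [Y hY]].
      by exists (Tst \o A) => h; rewrite big_ord1.
    exists ((Tst \o A) \+ (Tst \o (Y \o V))) => h; rewrite big_ord_recl /= hY linear_sum.
    by congr (_ + _); apply: eq_bigr => j _; rewrite /= -!iterS -iterSr.
  have /choice[Y hY] := sums.
  have YM n h : sqn ipK (Y n h) <= complex.Re C ^+ 2 * sqn ipH h.
    by apply: (sqn_leM fH fK); rewrite hY.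
  (* [T Tst = 1] gives [Y n V = T (Y (n+1)) - A], so [W] solves the equation for [- A] and is
     subtracted below. *)
  have [|W [WM WV]] := @intertwiner_of_bounded_sequence _ _ _ _ ipH fK cK dK T Tst (\- A) V Y _ 0 1 adjT YM.
    move=> n h; rewrite addn1 addn0 !hY [in RHS]big_ord_recl /= linearD TTst [RHS]addrC addKr linear_sum.
    by apply: eq_bigr => j _; rewrite /= /bump /= TTst add0n -(iterSr j V).
  have [s [s0 Ss]] := (bounded_opP fH fH S).1 bS; have [t [t0 Ft]] := (bdP F).1 bF.
  (* [F S] solves the equation for [F], since [S V = 1] and [T F = 0]. *)
  apply: (@similar_of_splitting _ _ _ _ _ fK fH T X V ((F \o S) \- W) (2 * (t * s) + 2 * complex.Re C ^+ 2)).
  + exact: cT.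
  + exact: cV.
  + move=> h /=; have := sqnB_le fK (F (S h)) (W h); have := WM h; have := Ft (S h).
    have : t * sqn ipH (S h) <= t * (s * sqn ipH h) by rewrite ler_wpM2l.
    lra.
  + move=> h /=; rewrite SV WV (linearB T) TF sub0r XE opprB.
    by rewrite addrCA addrA addrC.
Qed.
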